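(* Let $\underline\delta=(\delta_0,\delta,\ldots,\delta,\delta_n)\in(\mathbb{C}^* )^{n+1}$ and fix $\beta_0,\beta_1\in\mathbb{C}^*$. There exists a unique algebra homomorphism $\omega=\omega^{\underline\delta}_{\beta_0,\beta_1}:\mathrm{TL}(\underline\delta)\to\mathrm{End}_{\mathbb{C}}(\mathbb{C}[\mathcal M])$ such that, writing $e_j\mathfrak p:=\omega(e_j)\mathfrak p$ for $\mathfrak p\in\mathcal M$: for $1\le i<n$, $$e_i\mathfrak p=\begin{cases}\delta\,\mathfrak p & m_i(\mathfrak p)=i+1,\\ \delta_0^{\mathrm{pty}(i-1)}(\mathfrak p_i\cup\{\{i,i+1\}\}) & m_i(\mathfrak p)=0=m_{i+1}(\mathfrak p),\\ \delta_n^{\mathrm{pty}(n+1-i)}(\mathfrak p_i\cup\{\{i,i+1\}\}) & m_i(\mathfrak p)=n+1=m_{i+1}(\mathfrak p),\\ \beta_{\mathrm{pty}(i)}(\mathfrak p_i\cup\{\{i,i+1\}\}) & m_i(\mathfrak p)=0,\ m_{i+1}(\mathfrak p)=n+1,\\ \mathfrak p_i\cup\{\{i,i+1\},\{m_i(\mathfrak p),m_{i+1}(\mathfrak p)\}\} & \text{otherwise};\end{cases}$$ $$e_0\mathfrak p=\begin{cases}\delta_0\mathfrak p & m_1(\mathfrak p)=0,\\ \beta_0(\mathfrak p_0\cup\{\{0,1\}\}) & m_1(\mathfrak p)=n+1,\\ \mathfrak p_0\cup\{\{0,1\},\{0,m_1(\mathfrak p)\}\} & \text{otherwise};\end{cases}\qquad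 e_n\mathfrak p=\begin{cases}\delta_n\mathfrak p & m_n(\mathfrak p)=n+1,\\ \beta_{\mathrm{pty}(n)}(\mathfrak p_n\cup\{\{n,n+1\}\}) & m_n(\mathfrak p)=0,\\ \mathfrak p_n\cup\{\{n,n+1\},\{m_n(\mathfrak p),n+1\}\} & \text{otherwise}.\end{cases}$$
   Context: $\mathrm{TL}(\underline\delta)$ is the unital complex algebra with generators $e_0,\ldots,e_n$ and relations $e_i^2=\delta_ie_i$ ($0\le i\le n$, $\delta_i=\delta$ for $1\le i<n$), $e_ie_{i\pm1}e_i=e_i$ ($1\le i<n$), $e_ie_j=e_je_i$ ($|i-j|>1$). Let $[n+1]=\{0,1,\ldots,n+1\}$ and $\mathcal S$ the set of unordered pairs $\{i,j\}$, $i\ne j$, in $[n+1]$. A two-boundary non-crossing perfect matching is a subset $\mathfrak p\subseteq\mathcal S$ such that (1) each $i\in\{1,\ldots,n\}$ lies in exactly one pair of $\mathfrak p$; (2) there are no $\{i,j\},\{k,l\}\in\mathfrak p$ with $i<k<j<l$; (3) $\{0,n+1\}\notin\mathfrak p$ (the points $0,n+1$ may lie in several or no pairs). $\mathcal M$ is the set of these, and $\mathbb{C}[\mathcal M]$ the complex vector space with basis $\mathcal M$. For $\mathfrak p\in\mathcal M$ and $1\le i\le n$, $m_i(\mathfrak p)$ is the unique $j$ with $\{i,j\}\in\mathfrak p$. For $1\le i<n$, $\mathfrak p_i$ is $\mathfrak p$ with all pairs containing $i$ or $i+1$ removed; $\mathfrak p_0$ (resp. $\mathfrak p_n$) is $\mathfrak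 p$ with the pair containing $1$ (resp. $n$) removed. $\mathrm{pty}(i)=0$ for $i$ even, $1$ for $i$ odd. *)

(* Defs.v *)
From HB Require Import structures.
From mathcomp Require Import all_boot all_order all_algebra.
Set Implicit Arguments. Unset Strict Implicit. Unset Printing Implicit Defensive.
Import Order.TTheory GRing.Theory Num.Theory.

Section TL.
Variable R : fieldType.
Local Open Scope ring_scope.

Definition tl_param (n : nat) (d0 d dn : R) (i : nat) : R :=
  if i == 0%N then d0 else if i == n then dn else d.

Definition TL_relations (n : nat) (d0 d dn : R) (B : algType R)
    (b : 'I_n.+1 -> B) : Prop :=
  [/\ (forall i : 'I_n.+1, b i * b i = tl_param n d0 d dn i *: b i),
      (forall i j : 'I_n.+1, (1 <= i < n)%N -> (j == i.+1 :> nat) || (j.+1 == i :> nat) ->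
          b i * b j * b i = b i) &
      (forall i j : 'I_n.+1, (i.+1 < j)%N || (j.+1 < i)%N -> b i * b j = b j * b i)].

Definition is_alg_hom (A B : algType R) (f : A -> B) : Prop :=
  [/\ (forall x y, f (x + y) = f x + f y),
      (forall x y, f (x * y) = f x * f y),
      f 1 = 1 &
      (forall (c : R) x, f (c *: x) = c *: f x)].

Definition is_TL_presentation (n : nat) (d0 d dn : R) (A : algType R)
    (e : 'I_n.+1 -> A) : Prop :=
  TL_relations d0 d dn e /\
  forall (B : algType R) (b : 'I_n.+1 -> B), TL_relations d0 d dn b ->
    (exists f : A -> B, is_alg_hom f /\ forall i, f (e i) = b i) /\
    (forall f g : A -> B, is_alg_hom f -> is_alg_hom g ->
       (forall i, f (e i) = b i) -> (forall i, g (e i) = b i) -> f =1 g).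

End TL.

Definition pt (n k : nat) : 'I_n.+2 := inord k.

Definition is_matching (n : nat) (p : {set {set 'I_n.+2}}) : bool :=
  [&& [forall A in p, #|A| == 2%N],
      [forall i : 'I_n.+2, (1 <= i <= n)%N ==>
          (#|[set A in p | i \in A]| == 1%N)],
      [forall A in p, forall B in p, forall i : 'I_n.+2, forall j : 'I_n.+2,
         forall k : 'I_n.+2, forall l : 'I_n.+2,
         ((A == [set i; j]) && (B == [set k; l])) ==>
           ~~ [&& (i < k)%N, (k < j)%N & (j < l)%N]]
    & [set pt n 0; pt n n.+1] \notin p].

Definition matching (n : nat) := {p : {set {set 'I_n.+2}} | is_matching p}.

Definition mate (n : nat) (p : {set {set 'I_n.+2}}) (i : nat) : nat :=
  if [pick j : 'I_n.+2 | ([set pt n i; j] \in p) && (j != pt n i)] is Some j then nat_of_ord j else i.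

Definition remove_pts (n : nat) (p : {set {set 'I_n.+2}}) (i : nat) :=
  if i == 0%N then [set A in p | pt n 1 \notin A]
  else if i == n then [set A in p | pt n n \notin A]
  else [set A in p | (pt n i \notin A) && (pt n i.+1 \notin A)].

Definition pr (n a b : nat) : {set 'I_n.+2} := [set pt n a; pt n b].

Section Action.
Variable R : fieldType.
Local Open Scope ring_scope.
Variables (n : nat) (d0 d dn b0 b1 : R).

Definition beta (k : nat) : R := if odd k then b1 else b0.

(* e_j p = c * q : returns the pair (c, q) *)
Definition act (j : nat) (p : {set {set 'I_n.+2}}) : R * {set {set 'I_n.+2}} :=
  let pj := remove_pts p j in
  if j == 0%N then
    let m := mate p 1 in
    if m == 0%N then (d0, p)
    else if m == n.+1 then (b0, pr n 0 1 |: pj)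
    else (1, pr n 0 1 |: (pr n 0 m |: pj))
  else if j == n then
    let m := mate p n in
    if m == n.+1 then (dn, p)
    else if m == 0%N then (beta n, pr n n n.+1 |: pj)
    else (1, pr n n n.+1 |: (pr n m n.+1 |: pj))
  else
    let mi := mate p j in let mj := mate p j.+1 in
    if mi == j.+1 then (d, p)
    else if (mi == 0%N) && (mj == 0%N) then (d0 ^+ odd j.-1, pr n j j.+1 |: pj)
    else if (mi == n.+1) && (mj == n.+1) then (dn ^+ odd (n.+1 - j), pr n j j.+1 |: pj)
    else if (mi == 0%N) && (mj == n.+1) then (beta j, pr n j j.+1 |: pj)
    else (1, pr n j j.+1 |: (pr n mi mj |: pj)).

(* End_C(C[M]) is realised as square matrices of size dim = #|M| (written
   #|M|.-1.+1 so that it is an algebra; #|M| >= 1).  The k-th basis vector of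
   C[M] corresponds to the k-th matching of enum M. *)
Definition dimM : nat := #|{: matching n}|.-1.+1.

Definition basisM (k : nat) : {set {set 'I_n.+2}} :=
  nth set0 [seq val x | x <- enum {: matching n}] k.

Definition act_mx (j : nat) : 'M[R]_dimM :=
  \matrix_(r, c) (let: (coef, q) := act j (basisM c) in
                  if basisM r == q then coef else 0).

End Action.

(* Main.v *)
Require Import Defs.
From HB Require Import structures.
From mathcomp Require Import all_boot all_order all_algebra zify.
Import GRing.Theory Num.Theory.

Set Implicit Arguments.
Unset Strict Implicit.
Unset Printing Implicit Defensive.

(** A matching is encoded by its mate function, extended by [f 0 = 0] and
    [f n.+1 = n.+1].  With these two values the boundary generators [e_0] and
    [e_n] follow the same rule as the others: [e_j] joins [j] to [j.+1] and
    [f j] to [f j.+1].  All weights are then one expression in [f j] and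
    [f j.+1], and each relation is checked on mate functions.  Loops have
    weight [d], [d0] or [dn] by construction, and a zigzag [e_i e_j e_i] only
    meets even powers of [d0] and [dn].  Two distant generators commute because
    an arc joining interior points encloses only interior arcs, so that its
    ends have opposite parities: the two orders may detect a boundary weight at
    different positions, but these positions have the same parity. *)

(* The values of [f] above [n.+1] are irrelevant.  One orientation suffices in
   [nci_nc]: of two crossing pairs [a < c < b < d], [b] and [c] are interior,
   so the pairs are [{b, f b}] and [{c, f c}] with [f b < c < b < f c]. *)
Record noncrossing_involution (n : nat) (f : nat -> nat) : Prop := {
  nci_0 : f 0 = 0;
  nci_last : f n.+1 = n.+1;
  nci_le : forall x, x <= n.+1 -> f x <= n.+1;
  nci_neq : forall x, 0 < x <= n -> f x != x;
  nci_inv : forall x, x <= n.+1 -> 0 < f x <= n -> f (f x) = x;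
  nci_nc : forall x y, x <= n.+1 -> y <= n.+1 -> f x < y < x -> f x <= f y <= x
}.

(** The boundary points are tested first: they keep their fixed values when [j = 0] or [j = n], and
    also when they occur as [f j] or [f j.+1], since a boundary point may end several arcs. *)
Definition cupcap (n j : nat) (f : nat -> nat) (k : nat) : nat :=
  if k == 0 then 0
  else if k == n.+1 then n.+1
  else if k == j then j.+1
  else if k == j.+1 then j
  else if k == f j then f j.+1
  else if k == f j.+1 then f j
  else f k.

(** * Noncrossing involutions: nesting, parity and stability under [cupcap] *)

Section NoncrossingInvolution.
Variables (n : nat) (f : nat -> nat).
Hypothesis fP : noncrossing_involution n f.

Lemma nci_bounds x : x <= n.+1 ->
  [/\ f x <= n.+1, x = 0 -> f x = 0, x = n.+1 -> f x = n.+1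
    & 0 < x <= n -> f x <> x].
Proof.
move=> xn; split; first exact: nci_le.
- by move->; exact: nci_0 fP.
- by move->; exact: nci_last fP.
- by move=> x_in; apply/eqP; exact: nci_neq fP _ x_in.
Qed.

Lemma nci_pair x y : x <= n.+1 -> y <= n.+1 ->
  [/\ x = y -> f x = f y, 0 < y <= n -> f x = y -> f y = x,
      0 < x <= n -> f y = x -> f x = y
    & 0 < f x <= n -> f x = f y -> x = y].
Proof.
move=> xn yn; split; first by move->.
- by move=> yin fxy; rewrite -fxy (nci_inv fP) // fxy.
- by move=> xin fyx; rewrite -fyx (nci_inv fP) // fyx.
- move=> fxin fxy; rewrite -(nci_inv fP xn fxin) fxy (nci_inv fP) //.
  by rewrite -fxy.
Qed.

(** The clause [nci_nc] covers arcs running to the left of [x]. For [a < b < f a], an escape of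
    [f b] beyond [f a] makes [f a] interior and contradicts the clause at [f a]; an escape before
    [a] contradicts it at [b]. *)
Lemma nci_nest x y : x <= n.+1 -> y <= n.+1 ->
  [/\ f x < y < x -> f x <= f y <= x, x < y < f x -> x <= f y <= f x,
      f y < x < y -> f y <= f x <= y & y < x < f y -> y <= f x <= f y].
Proof.
move=> xn yn; have nest a b : a <= n.+1 -> b <= n.+1 ->
    a < b < f a -> a <= f b <= f a.
  move=> an bn ab; case: (leqP a (f b)) => afb.
    case: (leqP (f b) (f a)) => [//|fab].
    have [fan _ _ _] := nci_bounds an; have [fbn _ _ _] := nci_bounds bn.
    have ffa : f (f a) = a by apply: (nci_inv fP); lia.
    by have := nci_nc fP fan bn; rewrite ffa; lia.
  by have := nci_nc fP bn an; lia.
by split; [exact: (nci_nc fP) | exact: nest | exact: (nci_nc fP) | exact: nest].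
Qed.

(** Induction on the size: the arc at the first point [a] splits the rest into the points under it
    and the points after [f a], and both intervals are again stable. *)
Lemma nci_even_size a m : 0 < a -> a + m <= n.+1 ->
  (forall x, a <= x < a + m -> a <= f x < a + m) -> ~~ odd m.
Proof.
elim/ltn_ind: m a => -[//|m] IHm a a_gt0 am fa.
have fa_in : a <= f a < a + m.+1 by apply: fa; lia.
have an : a <= n.+1 by lia.
have [_ _ _ /(_ _)/eqP fa_neq] := nci_bounds an.
have {}fa_neq : f a != a by apply: fa_neq; lia.
have fneq x : a < x < a + m.+1 -> x != f a -> (f x != a) && (f x != f a).
  move=> x_in xfa; have xn : x <= n.+1 by lia.
  have [_ _ fxa inj] := nci_pair an xn; apply/andP; split; apply/eqP => fx.
    by rewrite fxa ?eqxx // in xfa; lia.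
  by move: x_in; rewrite (inj _ (esym fx)) ?ltnn //; lia.
have even1 : ~~ odd (f a - a.+1).
  apply: (IHm _ _ a.+1) => //; try lia.
  move=> x x_in; have fxneq := fneq x; have xn : x <= n.+1 by lia.
  by have [_ nest _ _] := nci_nest an xn; clear -x_in fa_in fxneq nest; lia.
have even2 : ~~ odd (a + m.+1 - (f a).+1).
  apply: (IHm _ _ (f a).+1) => //; try lia.
  move=> x x_in; have fxneq := fneq x; have xn : x <= n.+1 by lia.
  have x_a := fa x; have fan : f a <= n.+1 by lia.
  have ffa : f (f a) = a by apply: (nci_inv fP); lia.
  have [_ _ nest _] := nci_nest fan xn; rewrite ffa in nest.
  by clear -x_in fa_in fxneq nest x_a fa_neq; lia.
by clear -even1 even2 fa_in fa_neq; lia.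
Qed.

Lemma nci_odd x y : 0 < x <= n -> 0 < y <= n -> f x = y -> odd x = ~~ odd y.
Proof.
wlog xy : x y / x < y => [wlog_xy|].
  move=> xin yin fxy; have [xn yn] : x <= n.+1 /\ y <= n.+1 by lia.
  have [_ _ _ x_neq] := nci_bounds xn; have [_ fyx _ _] := nci_pair xn yn.
  case: (ltngtP x y) => xy; [exact: wlog_xy | | lia].
  by have := wlog_xy y x xy yin xin (fyx yin fxy); lia.
move=> xin yin fxy; have [xn yn] : x <= n.+1 /\ y <= n.+1 by lia.
have: ~~ odd (y - x.+1); last by lia.
apply: (@nci_even_size x.+1); try lia.
move=> z z_in; have zn : z <= n.+1 by lia.
have [_ _ fzx inj] := nci_pair xn zn; have [_ nest _ _] := nci_nest xn zn.
have fz1 : f z != x by apply/eqP => fz; have := fzx xin fz; lia.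
have fz2 : f z != y.
  by apply/eqP => fz; have := inj; rewrite fxy fz => /(_ yin erefl); lia.
by clear -nest z_in fz1 fz2 fxy; lia.
Qed.

(** In [CupcapOther], [f x] may equal [j] when [j = 0], and [j.+1] when [j = n]: a boundary point
    can end several arcs. *)
Variant cupcap_spec (j x : nat) : nat -> Prop :=
| CupcapFirst of x = 0 & f x = 0 : cupcap_spec j x 0
| CupcapLast of x = n.+1 & f x = n.+1 : cupcap_spec j x n.+1
| CupcapLeft of 0 < x <= n & x = j & f x = f j : cupcap_spec j x j.+1
| CupcapRight of 0 < x <= n & x = j.+1 & f x = f j.+1 : cupcap_spec j x j
| CupcapMateLeft of 0 < x <= n & x != j & x != j.+1 & f x = j & f j = x :
    cupcap_spec j x (f j.+1)
| CupcapMateRight of 0 < x <= n & x != j & x != j.+1 & f x = j.+1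
    & f j.+1 = x : cupcap_spec j x (f j)
| CupcapOther of 0 < x <= n & x != j & x != j.+1 & f j != x & f j.+1 != x
    & (j == 0) || (f x != j) & (j == n) || (f x != j.+1) :
    cupcap_spec j x (f x).

Lemma cupcapP j x : j <= n -> x <= n.+1 -> cupcap_spec j x (cupcap n j f x).
Proof.
move=> jn xn; have j0n : j <= n.+1 by lia.
have j1n : j.+1 <= n.+1 by lia.
rewrite /cupcap.
case: eqP => [->|?]; first by apply: CupcapFirst => //; exact: nci_0 fP.
case: eqP => [->|?]; first by apply: CupcapLast => //; exact: nci_last fP.
have x_in : 0 < x <= n by lia.
case: eqP => [xj|/eqP xj]; first by apply: CupcapLeft => //; rewrite xj.
case: eqP => [xj1|/eqP xj1]; first by apply: CupcapRight => //; rewrite xj1.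
have [_ xj0 jx0 _] := nci_pair xn j0n; have [_ xj2 jx1 _] := nci_pair xn j1n.
case: eqP => [fj|/eqP fj]; first by apply: CupcapMateLeft => //; exact: jx0.
case: eqP => [fj1|/eqP fj1]; first by apply: CupcapMateRight => //; exact: jx1.
apply: CupcapOther => //; rewrite 1?eq_sym //.
  case: eqVneq => //= j_neq0; apply/eqP => fxj; move/eqP: fj; apply.
  by rewrite xj0 //; lia.
case: eqVneq => //= j_neqn; apply/eqP => fxj; move/eqP: fj1; apply.
by rewrite xj2 //; lia.
Qed.

(** An arc that ends neither at [j] nor at [j.+1], shared boundary points aside, cannot separate
    these neighbours, hence cannot separate their mates. The new arc from [f j] to [f j.+1]
    therefore crosses no old one. *)
Lemma nci_arc_same_side j x : j <= n -> x <= n.+1 ->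
  x != j -> x != j.+1 -> (j == 0) || (f x != j) -> (j == n) || (f x != j.+1) ->
  [/\ f x < f j < x -> f x <= f j.+1 <= x,
      x < f j < f x -> x <= f j.+1 <= f x,
      f x < f j.+1 < x -> f x <= f j <= x
    & x < f j.+1 < f x -> x <= f j <= f x].
Proof.
move=> jn xn xj xj1 fxj fxj1.
have j0n : j <= n.+1 by lia.
have j1n : j.+1 <= n.+1 by lia.
have inner z : z <= n.+1 -> f x < f z < x -> f x <= z <= x.
  move=> zn fz; have [fzn _ _ _] := nci_bounds zn.
  have [nest _ _ _] := nci_nest xn fzn.
  rewrite (nci_inv fP) // in nest; last lia.
  exact: nest.
have outer z : z <= n.+1 -> x < f z < f x -> x <= z <= f x.
  move=> zn fz; have [fxn _ _ _] := nci_bounds xn.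
  have [fzn _ _ _] := nci_bounds zn.
  have [_ nest _ _] := nci_nest xn fzn.
  rewrite (nci_inv fP) // in nest; last lia.
  exact: nest.
have [n1 n2 _ _] := nci_nest xn j0n; have [n3 n4 _ _] := nci_nest xn j1n.
have [_ b1 _ _] := nci_bounds j0n; have [_ _ b2 _] := nci_bounds j1n.
have b2' : j = n -> f j.+1 = n.+1 by move=> jE; apply: b2; rewrite jE.
split=> fj_in.
- have {inner}j_in := inner _ j0n fj_in.
  by clear -n3 j_in fj_in b1 xj xj1 fxj; lia.
- have {outer}j_in := outer _ j0n fj_in.
  by clear -n4 j_in fj_in b1 b2' xj xj1 fxj fxj1 xn; lia.
- have {inner}j_in := inner _ j1n fj_in.
  by clear -n1 j_in fj_in b1 b2' xj xj1 fxj fxj1 xn; lia.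
- have {outer}j_in := outer _ j1n fj_in.
  by clear -n2 j_in fj_in b1 b2' xj xj1 fxj fxj1 xn; lia.
Qed.

(** For the noncrossing clause: the arc from [j] to [j.+1] has nothing under it, the arc joining the
    old mates is handled by [nci_arc_same_side], and two old arcs do not cross by [nci_nc]. *)
Lemma cupcap_nci j : 0 < n -> j <= n -> noncrossing_involution n (cupcap n j f).
Proof.
move=> n_gt0 jn.
have j0n : j <= n.+1 by lia.
have j1n : j.+1 <= n.+1 by lia.
split.
- by [].
- by rewrite /cupcap /= eqxx.
- move=> x xn; case: cupcapP => // *; try lia; exact: nci_le.
- move=> x x_in; have xn : x <= n.+1 by lia.
  have [_ _ _ xneq] := nci_bounds xn; have {}xneq := xneq x_in.
  have [_ _ _ inj] := nci_pair j0n j1n.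
  apply/eqP; case: cupcapP => // *; clear n_gt0; lia.
- move=> x xn; have inv_j := nci_inv fP j0n; have inv_j1 := nci_inv fP j1n.
  have [_ _ _ neq_j] := nci_bounds j0n; have [_ _ _ neq_j1] := nci_bounds j1n.
  have [_ _ _ neq_x] := nci_bounds xn.
  case: (cupcapP jn xn) => [||||||x_in ? ? ? ? ? ? fx_in].
  + by [].
  + by rewrite ltnn andbF.
  + by move=> *; case: cupcapP => *; lia.
  + by move=> *; case: cupcapP => *; lia.
  + move=> x_in xj xj1 fx fj fj_in; have {}inv_j1 := inv_j1 fj_in.
    by clear neq_x inv_j; case: cupcapP => *; lia.
  + move=> x_in xj xj1 fx fj1 fj_in; have {}inv_j := inv_j fj_in.
    by clear neq_x inv_j1; case: cupcapP => *; lia.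
  + have {inv_j inv_j1}inv_x := nci_inv fP xn fx_in.
    have {}neq_x := neq_x x_in; clear neq_j neq_j1.
    by case: cupcapP => *; lia.
- move=> x y xn yn.
  have xy := nci_nc fP xn yn.
  have xside := @nci_arc_same_side j x jn xn.
  have yside := @nci_arc_same_side j y jn yn.
  case: (cupcapP jn yn)
         => [? _|? _|_ ? _|_ ? _|_ ? ? _ ?|_ ? ? _ ?|_ ? ? ? ? ? ?];
    last have {yside}[| | | |? ? ? ?] := yside; try by [].
  all: case: (cupcapP jn xn)
         => [? _|? _|_ ? _|_ ? _|_ ? ? _ ?|_ ? ? _ ?|_ ? ? ? ? ? ?];
    last have {xside}[| | | |? ? ? ?] := xside; try by [].
  all: by clear n_gt0; lia.
Qed.

End NoncrossingInvolution.

(** * Commutation of distant generators *)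

Section Relations.
Variables (n : nat) (f : nat -> nat).
Hypothesis fP : noncrossing_involution n f.

Lemma cupcap_left j : 0 < j <= n -> cupcap n j f j = j.+1.
Proof. by move=> j_in; rewrite /cupcap eqxx !ifF //; lia. Qed.

Lemma cupcap_right j : j < n -> cupcap n j f j.+1 = j.
Proof. by move=> jn; rewrite /cupcap eqxx !ifF //; lia. Qed.

Lemma cupcapE j g x : cupcap n j g x =
  if x == 0 then 0
  else if x == n.+1 then n.+1
  else if x == j then j.+1
  else if x == j.+1 then j
  else if x == g j then g j.+1
  else if x == g j.+1 then g j
  else g x.
Proof. by []. Qed.

(* [cupcapP] restated without order relations, so that [congruence] can decide
   the case analyses below. *)
Variant cupcap_eq_spec (j x : nat) : nat -> Prop :=
| CupcapEqFirst of x = 0 & f x = 0 : cupcap_eq_spec j x 0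
| CupcapEqLast of x = n.+1 & f x = n.+1 : cupcap_eq_spec j x n.+1
| CupcapEqLeft of x <> 0 & x <> n.+1 & x = j & f x = f j :
    cupcap_eq_spec j x j.+1
| CupcapEqRight of x <> 0 & x <> n.+1 & x = j.+1 & f x = f j.+1 :
    cupcap_eq_spec j x j
| CupcapEqMateLeft of x <> 0 & x <> n.+1 & x <> j & x <> j.+1
    & f x = j & f j = x : cupcap_eq_spec j x (f j.+1)
| CupcapEqMateRight of x <> 0 & x <> n.+1 & x <> j & x <> j.+1
    & f x = j.+1 & f j.+1 = x : cupcap_eq_spec j x (f j)
| CupcapEqOther of x <> 0 & x <> n.+1 & x <> j & x <> j.+1
    & f j <> x & f j.+1 <> x : cupcap_eq_spec j x (f x).

Lemma cupcap_eqP j x : j <= n -> x <= n.+1 ->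
  cupcap_eq_spec j x (cupcap n j f x).
Proof. by move=> jn xn; case: (cupcapP fP jn xn) => *; constructor; lia. Qed.

Lemma nci_adjacent j : j <= n ->
  [\/ j = 0 /\ f j = 0, j = n /\ f j.+1 = n.+1,
      f j = j.+1 /\ f j.+1 = j
    | [/\ f j <> j, f j.+1 <> j.+1, f j <> j.+1 & f j.+1 <> j]].
Proof.
move=> jn; have [j0n j1n] : j <= n.+1 /\ j.+1 <= n.+1 by lia.
case: (posnP j) => [->|j_gt0]; first by apply: Or41; split; [|exact: nci_0 fP].
case: (eqVneq j n) => [->|j_neqn].
  by apply: Or42; split; [|exact: nci_last fP].
have [_ _ _ neq] := nci_bounds fP j0n; have [_ _ _ neq1] := nci_bounds fP j1n.
have [_ fj fj1 _] := nci_pair fP j0n j1n.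
case: (eqVneq (f j) j.+1) => [fjE|fj_neq].
  by apply: Or43; split=> //; apply: fj => //; lia.
by apply: Or44; split=> [||/eqP|fj1E]; lia.
Qed.

Lemma nci_adjacent_inj j : j <= n ->
  [\/ f j = 0, f j = n.+1 | f j <> f j.+1].
Proof.
move=> jn; have [j0n j1n] : j <= n.+1 /\ j.+1 <= n.+1 by lia.
have [_ _ _ inj] := nci_pair fP j0n j1n; have [le _ _ _] := nci_bounds fP j0n.
case: (eqVneq (f j) 0) => [|neq0]; first by apply: Or31.
case: (eqVneq (f j) n.+1) => [|neqn]; first by apply: Or32.
by apply: Or33 => /inj; lia.
Qed.

(** Locating [x], [j], [j.+1] relative to [e_i], and [x], [i], [i.+1] relative to [e_j], determines
    both composites; each case is then a matter of equalities only. *)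
Lemma cupcap_comm i j x : i.+1 < j -> j <= n -> x <= n.+1 ->
  cupcap n j (cupcap n i f) x = cupcap n i (cupcap n j f) x.
Proof.
move=> ij jn xn.
have i_n : i <= n by lia.
have [i0n i1n] : i <= n.+1 /\ i.+1 <= n.+1 by lia.
have [j0n j1n] : j <= n.+1 /\ j.+1 <= n.+1 by lia.
(* [congruence] ignores order, so the needed disequalities between positions are listed by hand. *)
have [ne1 ne2 ne3 ne4] : [/\ i <> j, i.+1 <> j, i <> j.+1 & i.+1 <> j.+1].
  by split; lia.
have [ne5 ne6 ne7 ne8] : [/\ i <> i.+1, j <> j.+1, i.+1 <> n.+1 & 0 <> j].
  by split; lia.
have [ne9 ne10 ne11 ne12] : [/\ i <> n.+1, j <> n.+1, i.+1 <> 0 & 0 <> j.+1].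
  by split; lia.
have ne13 : i <> n by lia.
rewrite !(cupcapE _ (cupcap _ _ _)).
case: (nci_adjacent i_n) => -[*]; case: (nci_adjacent jn) => -[*];
  try congruence.
all: case: (cupcap_eqP i_n xn) => *; case: (cupcap_eqP jn xn) => *;
  try congruence.
all: case: (cupcap_eqP i_n j0n) => *; try congruence.
all: case: (cupcap_eqP i_n j1n) => *; try congruence.
all: case: (cupcap_eqP jn i0n) => *; try congruence.
all: case: (cupcap_eqP jn i1n) => *; try congruence.
all: case: (nci_adjacent_inj i_n) => *; try congruence.
all: case: (nci_adjacent_inj jn) => *; try congruence.
all: repeat (case: eqP => *; try congruence).
Qed.

(* The ways in which [{i, i.+1}] and [{j, j.+1}] can be linked by arcs, with the
   mates of [i], [i.+1] after [e_j] and of [j], [j.+1] after [e_i]. *)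
Variant arc_link (i j u u' v v' : nat) : Prop :=
| NoLink of u = f i & u' = f i.+1 & v = f j & v' = f j.+1
| LinkInner of f i.+1 = j & f j = i.+1 & f i <> i.+1 & f j <> j.+1
    & (j <> n -> f i <> j.+1)
    & u = f i & u' = f j.+1 & v = f i & v' = f j.+1
| LinkLeft of i <> 0 & f i = j & f j = i & (j <> n -> f i.+1 <> j.+1)
    & f j.+1 <> i.+1
    & u = f j.+1 & u' = f i.+1 & v = f i.+1 & v' = f j.+1
| LinkRight of j <> n & f i.+1 = j.+1 & f j.+1 = i.+1 & f i <> i.+1
    & f j <> j.+1 & u = f i & u' = f j & v = f j & v' = f i
| LinkOuter of i <> 0 & j <> n & f i = j.+1 & f j.+1 = i & f j <> j.+1
    & f j <> i.+1 & u = f j & u' = f i.+1 & v = f j & v' = f i.+1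
| LinkNested of i <> 0 & j <> n & f i = j.+1 & f j = i.+1 & f i.+1 = j
    & f j.+1 = i & u = i.+1 & u' = i & v = j.+1 & v' = j
| LinkCross of i <> 0 & f i = j & f i.+1 = j.+1.

(** The analysis uses equalities only, so the crossing configuration [LinkCross] survives and is
    left to [weight_comm]. *)
Lemma arc_linkP i j : i.+1 < j -> j <= n ->
  arc_link i j (cupcap n j f i) (cupcap n j f i.+1)
               (cupcap n i f j) (cupcap n i f j.+1).
Proof.
move=> ij jn.
have i_n : i <= n by lia.
have [i0n i1n] : i <= n.+1 /\ i.+1 <= n.+1 by lia.
have [j0n j1n] : j <= n.+1 /\ j.+1 <= n.+1 by lia.
have [ne1 ne2 ne3 ne4] : [/\ i <> j, i.+1 <> j, i <> j.+1 & i.+1 <> j.+1].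
  by split; lia.
have [ne5 ne6 ne7 ne8] : [/\ i <> i.+1, j <> j.+1, i.+1 <> n.+1 & 0 <> j].
  by split; lia.
have [ne9 ne10 ne11 ne12] : [/\ i <> n.+1, j <> n.+1, i.+1 <> 0 & 0 <> j.+1].
  by split; lia.
have ne13 : i <> n by lia.
case: (nci_adjacent i_n) => -[*]; case: (nci_adjacent jn) => -[*];
  try congruence.
all: case: (cupcap_eqP i_n j0n) => *; try congruence.
all: case: (cupcap_eqP i_n j1n) => *; try congruence.
all: case: (cupcap_eqP jn i0n) => *; try congruence.
all: case: (cupcap_eqP jn i1n) => *; try congruence.
all: solve [apply: NoLink; congruence | apply: LinkInner => *; congruence
  | apply: LinkLeft => *; congruence | apply: LinkRight; congruence
  | apply: LinkOuter; congruence | apply: LinkNested; congruence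
  | apply: LinkCross; congruence].
Qed.

(** * Weights of loops and boundary arcs *)

Section Weight.
Variables (R : fieldType) (d0 d dn b0 b1 : R).
Local Open Scope ring_scope.

(* The loop test comes last: for [j = n] and [a = n.+1] it would otherwise
   shadow the weight [dn].  [odd j.+1] is the parity of [j - 1], also at
   [j = 0]. *)
Definition weight_of (j a b : nat) : R :=
  if (a == 0%N) && (b == 0%N) then d0 ^+ odd j.+1
  else if (a == n.+1) && (b == n.+1) then dn ^+ odd (n.+1 - j)
  else if (a == 0%N) && (b == n.+1) then beta b0 b1 j
  else if a == j.+1 then d else 1.

Definition weight (j : nat) (g : nat -> nat) : R := weight_of j (g j) (g j.+1).

Lemma weight_of_eq1 j a b : (0 < a <= n)%N || (0 < b <= n)%N -> a != j.+1 ->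
  weight_of j a b = 1.
Proof. by move=> ab aj; rewrite /weight_of !ifF //; lia. Qed.

Lemma weight_of_loop j : (0 < j < n)%N -> weight_of j j.+1 j = d.
Proof. by move=> j_in; rewrite /weight_of eqxx !ifF //; lia. Qed.

(** Boundary weights see [j] only through its parity. For [j = n] and [b = n.+1], the value
    [a = j.+1] is allowed because the test for [dn] precedes the loop test. *)
Lemma weight_of_parity i j a b : (i <= n)%N -> (j <= n)%N -> odd i = odd j ->
  a != i.+1 -> (a != j.+1) || (j == n) && (b == n.+1) ->
  weight_of i a b = weight_of j a b.
Proof.
move=> i_n jn oddij /negbTE ai.
rewrite /weight_of /beta /= !oddB ?leqW //= oddij ai.
case/orP=> [/negbTE-> //|/andP[/eqP-> /eqP->]].
by rewrite eqxx /= andbF andbT; case: (a == n.+1).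
Qed.

Lemma weight_comm i j : (i.+1 < j)%N -> (j <= n)%N ->
  weight i f * weight j (cupcap n i f) = weight j f * weight i (cupcap n j f).
Proof.
move=> ij jn.
have i_n : (i <= n)%N by lia.
have [i0n i1n] : (i <= n.+1 /\ i.+1 <= n.+1)%N by lia.
have [j0n j1n] : (j <= n.+1 /\ j.+1 <= n.+1)%N by lia.
rewrite /weight; case: (arc_linkP ij jn).
- by move=> -> -> -> ->; rewrite mulrC.
(* The arc from [i.+1] to [j] gives [i] and [j] the same parity. In either order one factor is [1]
   and the other sees the mates [f i] and [f j.+1], once at [j] and once at [i]. *)
- move=> fi1 fj fi_neq fj_neq fij -> -> -> ->.
  rewrite (@weight_of_eq1 i) ?(@weight_of_eq1 j (f j)); try lia.
  have /= odd_i := @nci_odd n f fP i.+1 j _ _ fi1.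
  have [_ _ fj1 _] := nci_bounds fP j1n.
  by rewrite (@weight_of_parity i j) //; lia.
(* [f i.+1] lies under the arc from [i] to [j], so it is interior and all four weights are [1]. In
   the next two cases [f j] plays this role. *)
- move=> i_neq0 fi fj fij1 fj1i -> -> -> ->.
  have fi1 : (0 < f i.+1 <= n)%N.
    by have [_ nest _ _] := nci_nest fP i0n i1n; lia.
  have [fi1_neq fj1_neq] : f i.+1 != j.+1 /\ f j.+1 != i.+1 by lia.
  by rewrite !weight_of_eq1 //; lia.
- move=> j_neqn fi1 fj1 fi_neq fj_neq -> -> -> ->.
  have fj : (0 < f j <= n)%N.
    by have [nest _ _ _] := nci_nest fP j1n j0n; lia.
  have [? ?] : f i != i.+1 /\ f j != j.+1 by split; apply/eqP.
  by rewrite !weight_of_eq1 //; lia.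
- move=> i_neq0 j_neqn fi fj1 fj_neq fji -> -> -> ->.
  have fj : (0 < f j <= n)%N.
    by have [nest _ _ _] := nci_nest fP j1n j0n; lia.
  have [? ?] : f j != i.+1 /\ f j != j.+1 by split; apply/eqP.
  by rewrite !weight_of_eq1 //; lia.
(* With two nested arcs, whichever generator acts second closes a loop of weight [d]. *)
- move=> i_neq0 j_neqn fi fj fi1 fj1 -> -> -> ->.
  by rewrite !weight_of_loop ?weight_of_eq1 //; lia.
(* The arcs from [i] to [j] and from [i.+1] to [j.+1] would cross. *)
- move=> i_neq0 fi fi1.
  by have [_ nest _ _] := nci_nest fP i0n i1n; lia.
Qed.

(** For [j = 0] both mates are [0] and for [j = n] both are [n.+1], with exponent [1] in each case;
    otherwise [j] and [j.+1] form a loop. *)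
Lemma weight_loop j : (0 < n)%N -> (j <= n)%N ->
  weight j (cupcap n j f) = tl_param n d0 d dn j.
Proof.
move=> n_gt0 jn; rewrite /weight /tl_param.
case: (posnP j) => [->|j_gt0].
  by rewrite /cupcap eqxx /= ifF ?eqxx //=; lia.
rewrite cupcap_left ?j_gt0 //; case: (eqVneq j n) => [->|j_neqn].
  by rewrite /cupcap /= eqxx /weight_of /= eqxx /= subSnn.
by rewrite cupcap_right ?weight_of_loop //; lia.
Qed.

End Weight.

End Relations.

(** * Loops and zigzags on mate functions *)

Section Straightening.
Variables (n : nat) (f : nat -> nat).
Hypothesis fP : noncrossing_involution n f.

Lemma cupcap_fixed j x : j <= n -> x <= n.+1 ->
  (j == 0) || (f j == j.+1) -> (j == n) || (f j.+1 == j) ->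
  cupcap n j f x = f x.
Proof.
move=> jn xn fj fj1.
have j0n : j <= n.+1 by lia.
have j1n : j.+1 <= n.+1 by lia.
have [_ b1 _ _] := nci_bounds fP j0n; have [_ _ b2 _] := nci_bounds fP j1n.
by case: cupcapP => * //; lia.
Qed.

Section Zigzag.
Variable i : nat.
Hypotheses (i_in : 0 < i < n) (fi : f i = i.+1) (fi1 : f i.+1 = i).

(** [e_{i+1}] joins [i] to [f i.+2]; then [e_i] hands this mate back to [i.+2] and restores the arc
    from [i] to [i.+1]. *)
Lemma cupcap_zigzag_up x : x <= n.+1 ->
  cupcap n i (cupcap n i.+1 f) x = f x.
Proof.
move=> xn; have i1n : i < n by lia.
have [xi0 xi1] : i <= n.+1 /\ i.+1 <= n.+1 by lia.
have xi2 : i.+2 <= n.+1 by lia.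
have [ne1 ne2 ne3 ne4] : [/\ i <> i.+1, i <> i.+2, i <> 0 & i <> n].
  by split; lia.
have [ne5 ne6] : i.+1 <> i.+2 /\ i <> n.+1 by lia.
rewrite cupcapE.
case: (cupcap_eqP fP i1n xn) => *; try congruence.
all: case: (cupcap_eqP fP i1n xi0) => *; try congruence.
all: case: (cupcap_eqP fP i1n xi1) => *; try congruence.
all: repeat (case: eqP => *; try congruence).
Qed.

Lemma cupcap_zigzag_down x : x <= n.+1 ->
  cupcap n i (cupcap n i.-1 f) x = f x.
Proof.
case: i i_in fi fi1 => // k k_in fk fk1.
move=> xn; have i1n : k <= n by lia.
have [xi0 xi1] : k <= n.+1 /\ k.+1 <= n.+1 by lia.
have xi2 : k.+2 <= n.+1 by lia.
have [ne1 ne2 ne3 ne4] : [/\ k <> k.+1, k <> k.+2, k <> n.+1 & k <> n].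
  by split; lia.
have [ne5 ne6] : k.+1 <> k.+2 /\ k.+1 <> n by lia.
rewrite cupcapE /=.
case: (cupcap_eqP fP i1n xn) => *; try congruence.
all: case: (cupcap_eqP fP i1n xi2) => *; try congruence.
all: case: (cupcap_eqP fP i1n xi1) => *; try congruence.
all: repeat (case: eqP => *; try congruence).
Qed.

Section Weight.
Variables (R : fieldType) (d0 d dn b0 b1 : R).
Local Open Scope ring_scope.
Local Notation weight := (weight n d0 d dn b0 b1).

Lemma weight_zigzag_up :
  weight i.+1 f = 1 /\ weight i (cupcap n i.+1 f) = 1.
Proof.
split; first by rewrite /weight fi1 weight_of_eq1 //; lia.
rewrite /weight cupcap_left; last by lia.
have -> : cupcap n i.+1 f i = f i.+2.
  by rewrite cupcapE fi1 eqxx !ifF //; lia.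
(* For [i.+1 = n] both mates are [n.+1], and the exponent of [dn] is [odd 2], that is [0]. *)
case: (eqVneq i.+1 n) => [i1n|i1_neqn].
  rewrite i1n (nci_last fP) /weight_of /= eqxx /= -i1n.
  by have -> : (i.+2 - i = 2)%N by lia.
have [i1n i2n] : (i.+1 <= n.+1 /\ i.+2 <= n.+1)%N by lia.
have [_ _ fi2 _] := nci_pair fP i1n i2n.
by rewrite weight_of_eq1 //; lia.
Qed.

Lemma weight_zigzag_down :
  weight i.-1 f = 1 /\ weight i (cupcap n i.-1 f) = 1.
Proof.
case: i i_in fi fi1 => // k k_in fk1 fk2 /=.
have [k0n k1n] : (k <= n.+1 /\ k.+1 <= n.+1)%N by lia.
have [_ fk _ inj] := nci_pair fP k0n k1n.
split; first by rewrite /weight fk1 weight_of_eq1 //; lia.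
rewrite /weight.
have -> : cupcap n k f k.+1 = k by rewrite cupcapE eqxx !ifF //; lia.
have [_ fk0 _ _] := nci_bounds fP k0n.
have -> : cupcap n k f k.+2 = f k by rewrite cupcapE fk1 eqxx !ifF //; lia.
(* For [k = 0] both mates are [0], and the exponent of [d0] is again [odd 2]. *)
case: (posnP k) => [k0|k_gt0]; first by rewrite fk0 // k0 /weight_of.
by rewrite weight_of_eq1 //; lia.
Qed.

End Weight.

End Zigzag.

End Straightening.

(** * Pairs of points named by natural numbers *)

Section Pairs.
Variable n : nat.
Implicit Types a b c d k : nat.

Lemma ptK k : k <= n.+1 -> pt n k = k :> nat.
Proof. by move=> kn; rewrite /pt inordK. Qed.

Lemma pt_val (i : 'I_n.+2) : pt n i = i.
Proof. exact: inord_val. Qed.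

Lemma pt_eq a b : a <= n.+1 -> b <= n.+1 -> (pt n a == pt n b) = (a == b).
Proof. by move=> an bn; rewrite -val_eqE /= !ptK. Qed.

Lemma prC a b : pr n a b = pr n b a.
Proof. exact: setUC. Qed.

Lemma in_pr k a b : k <= n.+1 -> a <= n.+1 -> b <= n.+1 ->
  (pt n k \in pr n a b) = (k == a) || (k == b).
Proof. by move=> kn an bn; rewrite !inE !pt_eq. Qed.

Lemma pr_inj a b c d : a <= n.+1 -> b <= n.+1 -> c <= n.+1 -> d <= n.+1 ->
  pr n a b = pr n c d -> a = c /\ b = d \/ a = d /\ b = c.
Proof.
move=> an bn cn dn /setP eq_pr.
have := eq_pr (pt n a); have := eq_pr (pt n b).
have := eq_pr (pt n c); have := eq_pr (pt n d).
rewrite !in_pr // !eqxx !orbT /=.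
lia.
Qed.

Lemma card_pr a b : a <= n.+1 -> b <= n.+1 -> a != b -> #|pr n a b| = 2.
Proof. by move=> an bn ab; rewrite cards2 pt_eq // ab. Qed.

End Pairs.

(** * From mate functions to matchings *)

Definition arcs (n : nat) (f : nat -> nat) : {set {set 'I_n.+2}} :=
  [set pr n i (f i) | i : 'I_n.+2 & 0 < i <= n].

Lemma arcsP n f A :
  reflect (exists2 x, 0 < x <= n & A = pr n x (f x)) (A \in arcs n f).
Proof.
apply: (iffP imsetP) => [[i i_in ->]|[x x_in ->]].
  by exists i; rewrite // inE in i_in.
have xn : x <= n.+1 by lia.
by exists (pt n x); rewrite ?inE ptK.
Qed.

Lemma mem_arcs n f x : 0 < x <= n -> pr n x (f x) \in arcs n f.
Proof. by move=> x_in; apply/arcsP; exists x. Qed.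

Lemma eq_arcs n f g : (forall x, 0 < x <= n -> f x = g x) ->
  arcs n f = arcs n g.
Proof.
by move=> fg; apply/setP => A; apply/arcsP/arcsP => -[x x_in ->];
  exists x => //; rewrite fg.
Qed.

Section Arcs.
Variables (n : nat) (f : nat -> nat).
Hypothesis fP : noncrossing_involution n f.

Lemma pr_arcs a b : a <= n.+1 -> b <= n.+1 -> pr n a b \in arcs n f ->
  0 < a <= n /\ f a = b \/ 0 < b <= n /\ f b = a.
Proof.
move=> an bn /arcsP[x x_in]; have xn : x <= n.+1 by lia.
have [fxn _ _ _] := nci_bounds fP xn.
by case/(pr_inj an bn xn fxn) => -[-> ->]; [left|right].
Qed.

Lemma pr_arcs_mate a b : 0 < a <= n -> b <= n.+1 -> pr n a b \in arcs n f ->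
  b = f a.
Proof.
move=> a_in bn; have an : a <= n.+1 by lia.
case/(pr_arcs an bn) => [[] //|[b_in fb]].
by have [_ _ fab _] := nci_pair fP an bn; rewrite fab.
Qed.

Lemma arcs_noncrossing a b c d :
  a <= n.+1 -> b <= n.+1 -> c <= n.+1 -> d <= n.+1 ->
  pr n a b \in arcs n f -> pr n c d \in arcs n f ->
  ~~ [&& a < c, c < b & b < d].
Proof.
move=> an bn cn dn /(pr_arcs an bn) ab /(pr_arcs cn dn) cd.
apply/negP => /and3P[ac cb bd].
have fb : f b = a.
  case: ab => -[_ fab //]; have [_ fba _ _] := nci_pair fP an bn.
  by apply: fba => //; lia.
have fc : f c = d.
  case: cd => -[_ fcd //]; have [_ _ fdc _] := nci_pair fP cn dn.
  by apply: fdc => //; lia.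
by have := nci_nc fP bn cn; rewrite fb fc; lia.
Qed.

(** [arcs] uses interior points only, and [f] moves these, so no singleton occurs; the pair of [0]
    and [n.+1] does not occur because neither end is interior. *)
Lemma arcs_is_matching : is_matching (arcs n f).
Proof.
apply/and4P; split.
- apply/forall_inP => A /arcsP[x x_in ->].
  have xn : x <= n.+1 by lia.
  have [fxn _ _ fx] := nci_bounds fP xn; apply/eqP/card_pr => //.
  by apply/eqP => xfx; case: fx.
- apply/forall_inP => i i_in; apply/cards1P; exists (pr n i (f i)).
  have ii : (i <= n.+1) by rewrite -ltnS.
  apply/setP => A; rewrite !inE; apply/andP/eqP => [[/arcsP[x x_in ->]]|->].
    have xn : x <= n.+1 by lia.
    have [fxn _ _ _] := nci_bounds fP xn.
    rewrite -{1}(pt_val i) in_pr // => /orP[/eqP<- //|/eqP ifx].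
    by have [_ fi _ _] := nci_pair fP xn ii; rewrite fi // prC ifx.
  rewrite mem_arcs // -{1}(pt_val i) in_pr ?eqxx //.
  by have [] := nci_bounds fP ii.
- apply/forall_inP => A Ap; apply/forall_inP => B Bp.
  apply/forallP => i; apply/forallP => j.
  apply/forallP => k; apply/forallP => l.
  apply/implyP => /andP[/eqP AE /eqP BE].
  by apply: arcs_noncrossing; rewrite -1?ltnS // /pr !pt_val -?AE -?BE.
- apply/negP => /pr_arcs [] // -[]; lia.
Qed.

Lemma mate_arcs x : 0 < x <= n -> mate (arcs n f) x = f x.
Proof.
move=> x_in; have xn : x <= n.+1 by lia.
have [fxn _ _ fx] := nci_bounds fP xn.
rewrite /mate; case: pickP => [j /andP[xj _]|/(_ (pt n (f x)))].
  by apply: pr_arcs_mate; rewrite -1?ltnS // /pr pt_val.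
rewrite mem_arcs //= pt_eq // => /negbFE/eqP fxx.
by case: fx.
Qed.

End Arcs.

(** * From matchings to mate functions *)

Section MatchingFunction.
Variables (n : nat) (p : {set {set 'I_n.+2}}).
Hypothesis pP : is_matching p.

(** At [0] and [n.+1], [mate] would pick one of possibly several partners, so the fixed values
    required of a mate function are imposed. *)
Definition mate_fun (x : nat) : nat := if 0 < x <= n then mate p x else x.

Lemma matching_pair A : A \in p ->
  exists a b, [/\ a <= n.+1, b <= n.+1, a < b & A = pr n a b].
Proof.
case/and4P: pP => /forall_inP p2 _ _ _ Ap.
case/cards2P: (p2 A Ap) => a [b [ab ->]].
wlog lt_ab : a b ab / a < b => [wlog_ab|].
  case: (ltngtP a b) => [|lt_ba|/val_inj ba]; first exact: wlog_ab.
    by rewrite setUC; apply: wlog_ab; rewrite // eq_sym.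
  by rewrite ba eqxx in ab.
by exists a, b; rewrite /pr !pt_val -ltnS ltn_ord -ltnS ltn_ord.
Qed.

Lemma matching_uniq a b c : 0 < a <= n -> b <= n.+1 -> c <= n.+1 ->
  pr n a b \in p -> pr n a c \in p -> b = c.
Proof.
move=> a_in bn cn abp acp; have an : a <= n.+1 by lia.
case/and4P: pP => _ /forall_inP p1 _ _.
have /cards1P[B BE] : #|[set A in p | pt n a \in A]| == 1.
  by apply: p1; rewrite ptK.
have /set1P ab : pr n a b \in [set B] by rewrite -BE inE abp in_pr // eqxx.
have /set1P ac : pr n a c \in [set B] by rewrite -BE inE acp in_pr // eqxx.
by case: (pr_inj an bn an cn (etrans ab (esym ac))) => -[]; [|move=> ->].
Qed.

Lemma mateP x : 0 < x <= n ->
  [/\ mate p x <= n.+1, mate p x != x & pr n x (mate p x) \in p].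
Proof.
move=> x_in; have xn : x <= n.+1 by lia.
rewrite /mate; case: pickP => [j /andP[xjp jx]|no_mate].
  by rewrite -ltnS ltn_ord /pr pt_val; split=> //; rewrite -(ptK xn).
case/and4P: pP => _ /forall_inP p1 _ _.
have /cards1P[B BE] : #|[set A in p | pt n x \in A]| == 1.
  by apply: p1; rewrite ptK.
have: B \in [set B] by rewrite inE.
rewrite -BE inE => /andP[Bp]; have [a [b [an bn ab BE']]] := matching_pair Bp.
rewrite BE' in_pr // => /orP[] /eqP xE.
  have := no_mate (pt n b); rewrite -/(pr n x b) xE -BE' Bp pt_eq //=.
  by lia.
have := no_mate (pt n a); rewrite -/(pr n x a) prC xE -BE' Bp pt_eq //=.
by lia.
Qed.

Lemma matching_nc a b c d :
  a <= n.+1 -> b <= n.+1 -> c <= n.+1 -> d <= n.+1 ->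
  pr n a b \in p -> pr n c d \in p -> ~~ [&& a < c, c < b & b < d].
Proof.
move=> an bn cn dn abp cdp; case/and4P: pP => _ _ /forall_inP nc _.
have /forall_inP/(_ _ cdp)/forallP/(_ (pt n a)) := nc _ abp.
move=> /forallP/(_ (pt n b))/forallP/(_ (pt n c))/forallP/(_ (pt n d)).
by rewrite !ptK // !eqxx.
Qed.

Lemma mate_fun_nci : noncrossing_involution n mate_fun.
Proof.
have inv x : x <= n.+1 -> 0 < mate_fun x <= n -> mate_fun (mate_fun x) = x.
  move=> xn m_in; have x_in : 0 < x <= n.
    by move: m_in; rewrite /mate_fun; case: ifP => // ->.
  have mE : mate_fun x = mate p x by rewrite /mate_fun x_in.
  have [mn mx mp] := mateP x_in; rewrite mE in m_in *; rewrite /mate_fun m_in.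
  have [mmn _ mmp] := mateP m_in.
  by apply: matching_uniq mmp _; rewrite // prC.
split.
- by [].
- by rewrite /mate_fun ifF //; lia.
- by move=> x xn; rewrite /mate_fun; case: ifP => // /mateP[].
- by move=> x x_in; rewrite /mate_fun x_in; have [] := mateP x_in.
- exact: inv.
- move=> x y xn yn fxyx.
  have x_in : 0 < x <= n.
    by move: fxyx; rewrite {1}/mate_fun; case: ifP => //; lia.
  have y_in : 0 < y <= n by lia.
  move: fxyx; rewrite /mate_fun x_in y_in => fxyx.
  have [mx _ mxp] := mateP x_in; have [my _ myp] := mateP y_in.
  have myp' := myp; rewrite prC in myp'; rewrite prC in mxp.
  (* The mate of [y] could escape to the left or to the right; each is a crossing for one order of
     the two pairs. *)
  have nc1 := matching_nc my yn mx xn myp' mxp.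
  have nc2 := matching_nc mx xn yn my mxp myp.
  by lia.
Qed.

Lemma arcs_mate_fun : arcs n mate_fun = p.
Proof.
apply/setP => A; apply/arcsP/idP => [[x x_in ->]|Ap].
  by rewrite /mate_fun x_in; have [] := mateP x_in.
have [a [b [an bn ab AE]]] := matching_pair Ap.
case/and4P: pP => _ _ _ no_0n.
(* Since the pair of [0] and [n.+1] is excluded, every pair has an interior end. *)
have : 0 < a <= n \/ 0 < b <= n.
  have : (a == 0) && (b == n.+1) = false; last by lia.
  apply/negP => /andP[/eqP a0 /eqP bn1].
  by move: Ap; rewrite AE a0 bn1; apply/negP.
case=> x_in.
  have [mn _ mp] := mateP x_in; exists a; rewrite // /mate_fun x_in AE.
  by rewrite AE in Ap; rewrite (matching_uniq x_in bn mn Ap mp).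
have [mn _ mp] := mateP x_in; exists b; rewrite // /mate_fun x_in AE prC.
by rewrite AE prC in Ap; rewrite (matching_uniq x_in an mn Ap mp).
Qed.

End MatchingFunction.

(** * The action on matchings through mate functions *)

Section Action.
Variables (n : nat) (f : nat -> nat).
Hypotheses (n_gt0 : 0 < n) (fP : noncrossing_involution n f).

Lemma mem_remove_pts j x : j <= n -> 0 < x <= n ->
  (pr n x (f x) \in remove_pts (arcs n f) j) =
  [&& x != j, x != j.+1, (j == 0) || (f x != j) & (j == n) || (f x != j.+1)].
Proof.
move=> jn x_in; have xn : x <= n.+1 by lia.
have [fxn _ _ _] := nci_bounds fP xn.
rewrite /remove_pts; case: (eqVneq j 0) => [->|j_neq0].
  by rewrite inE mem_arcs // in_pr //; lia.
case: (eqVneq j n) => [->|j_neqn].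
  by rewrite inE mem_arcs // in_pr //; lia.
by rewrite inE mem_arcs // !in_pr //; lia.
Qed.

Lemma remove_pts_sub j : remove_pts (arcs n f) j \subset arcs n f.
Proof.
apply/subsetP => A; rewrite /remove_pts.
by do 2?case: ifP => _; rewrite inE => /andP[].
Qed.

(** If neither mate is interior, joining them would give a singleton or the forbidden pair of [0]
    and [n.+1]; no such pair is added. *)
Lemma arcs_cupcap j : j <= n ->
  arcs n (cupcap n j f) = pr n j j.+1 |:
    ((if (0 < f j <= n) || (0 < f j.+1 <= n) then [set pr n (f j) (f j.+1)]
      else set0) :|: remove_pts (arcs n f) j).
Proof.
move=> jn.
have [j0n j1n] : j <= n.+1 /\ j.+1 <= n.+1 by lia.
apply/setP => A; apply/idP/idP.
  case/arcsP=> x x_in ->; have xn : x <= n.+1 by lia.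
  rewrite !in_setU in_set1.
  case: (cupcapP fP jn xn)
    => [x0|x0|_ -> _|_ -> _|_ _ _ _ fj|_ _ _ _ fj|_ xj xj1 _ _ fxj fxj1].
  - by lia.
  - by lia.
  - by rewrite eqxx.
  - by rewrite prC eqxx.
  - by rewrite fj x_in /= in_set1 eqxx orbT.
  - by rewrite fj x_in orbT /= prC in_set1 eqxx orbT.
  - by rewrite mem_remove_pts // xj xj1 fxj fxj1 !orbT.
rewrite !in_setU in_set1 => /orP[/eqP->|/orP[]].
- case: (posnP j) => [j0|j_gt0].
    apply/arcsP; exists j.+1; first lia.
    by rewrite prC /cupcap eqxx !ifF //; lia.
  by apply/arcsP; exists j; rewrite ?cupcap_left //; lia.
- case: ifP => [int_j|_]; last by rewrite inE.
  have [b0 b1 _ b2] := nci_bounds fP j0n.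
  have [b3 _ b4 b5] := nci_bounds fP j1n.
  have [_ p1 p2 p3] := nci_pair fP j0n j1n.
  have inv_j := nci_inv fP j0n; have inv_j1 := nci_inv fP j1n.
  move/set1P->; apply/arcsP; case/orP: int_j => x_in.
    exists (f j) => //; have {inv_j1}inv_j := inv_j x_in.
    have fjn : f j <= n.+1 by lia.
    suff -> : cupcap n j f (f j) = f j.+1 by [].
    by case: (cupcapP fP jn fjn) => *; lia.
  exists (f j.+1) => //; have {inv_j}inv_j1 := inv_j1 x_in.
  have fjn : f j.+1 <= n.+1 by lia.
  rewrite prC; suff -> : cupcap n j f (f j.+1) = f j by [].
  by case: (cupcapP fP jn fjn) => *; lia.
move=> Ar; have /arcsP[x x_in AE] := subsetP (remove_pts_sub j) _ Ar.
move: Ar; rewrite AE mem_remove_pts // => /and4P[xj xj1 fxj fxj1].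
have xn : x <= n.+1 by lia.
have [_ b1 _ _] := nci_bounds fP j0n; have [_ _ b4 _] := nci_bounds fP j1n.
apply/arcsP; exists x => //; suff -> : cupcap n j f x = f x by [].
by case: (cupcapP fP jn xn) => // *; lia.
Qed.

Section Weighted.
Variables (R : fieldType) (d0 d dn b0 b1 : R).
Local Open Scope ring_scope.
Local Notation weight := (weight n d0 d dn b0 b1).

Lemma act_arcs j : (j <= n)%N ->
  act d0 d dn b0 b1 j (arcs n f) = (weight j f, arcs n (cupcap n j f)).
Proof.
move=> jn.
(* The branches of [act] have three shapes: nothing changes, the old mates get joined, or both are
   boundary points and do not. *)
have loop : (j == 0%N) || (f j == j.+1) -> (j == n) || (f j.+1 == j) ->
    arcs n (cupcap n j f) = arcs n f.
  by move=> fj fj1; apply: eq_arcs => x x_in; apply: cupcap_fixed => //; lia.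
have inner : ((0 < f j <= n) || (0 < f j.+1 <= n))%N -> arcs n (cupcap n j f) =
    pr n j j.+1 |: (pr n (f j) (f j.+1) |: remove_pts (arcs n f) j).
  by move=> int_j; rewrite arcs_cupcap // int_j.
have outer : ~~ ((0 < f j <= n) || (0 < f j.+1 <= n))%N ->
    arcs n (cupcap n j f) = pr n j j.+1 |: remove_pts (arcs n f) j.
  by move=> /negbTE out_j; rewrite arcs_cupcap // out_j set0U.
have [j0n j1n] : (j <= n.+1 /\ j.+1 <= n.+1)%N by lia.
have [fjn fj0 _ fj] := nci_bounds fP j0n.
have [fj1n _ fj1_last fj1] := nci_bounds fP j1n.
have [_ p1 p2 _] := nci_pair fP j0n j1n.
rewrite /act; case: (posnP j) => [j0|j_gt0].
  subst j; rewrite mate_arcs // /weight /weight_of {}fj0 //= in inner outer *.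
  case: (eqVneq (f 1) 0%N) => [f1|f1_neq0].
    by rewrite loop ?f1 ?orbT.
  case: (eqVneq (f 1) n.+1) => [f1|f1_neqn]; first by rewrite outer ?f1 // ltnn.
  by rewrite inner //; lia.
case: (eqVneq j n) => [jE|j_neqn].
  subst j; rewrite mate_arcs ?n_gt0 ?leqnn // /weight /weight_of.
  rewrite fj1_last //= eqxx andbT andbF in inner outer *.
  case: (eqVneq (f n) n.+1) => [fn|fn_neqn].
    by rewrite loop ?fn ?eqxx ?orbT //= subSnn expr1.
  case: (eqVneq (f n) 0%N) => [fn|fn_neq0].
    by rewrite outer // fn /= ltnn.
  by rewrite inner //; lia.
have [j_in j1_in] : ((0 < j <= n) /\ (0 < j.+1 <= n))%N by lia.
rewrite !mate_arcs // /weight /weight_of.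
case: (eqVneq (f j) j.+1) => [fjE|fj_neq].
  have fj1E : f j.+1 = j by exact: p1.
  by rewrite loop ?fjE ?fj1E ?eqxx ?orbT // !ifF //; lia.
have -> : odd j.-1 = odd j.+1 by lia.
case: ifP => [/andP[/eqP fj_0 /eqP fj1_0]|neq1].
  by rewrite outer // fj_0 fj1_0.
case: ifP => [/andP[/eqP fj_n /eqP fj1_n]|neq2].
  by rewrite outer // fj_n fj1_n ltnn.
case: ifP => [/andP[/eqP fj_0 /eqP fj1_n]|neq3].
  by rewrite outer // fj_0 fj1_n /= ltnn.
(* Mates [n.+1] of [j] and [0] of [j.+1] would give crossing arcs, so in the remaining case one mate
   is interior. *)
have nc : f j = n.+1 -> f j.+1 <> 0%N.
  by move=> fj_n fj1_0; have := nci_nc fP j1n j0n; rewrite fj_n fj1_0; lia.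
rewrite inner //; clear loop inner outer p1 p2 fj fj1 fj0 fj1_last; lia.
Qed.

End Weighted.

End Action.

Local Open Scope ring_scope.

(** * The matrices of the action and their relations *)

Section Matrices.
Variables (R : fieldType) (n : nat) (d0 d dn b0 b1 : R).
Hypothesis n_gt0 : (0 < n)%N.
Local Notation weight := (weight n d0 d dn b0 b1).
Local Notation nci := (noncrossing_involution n).
Local Notation E := (act_mx n d0 d dn b0 b1).

(** All interior points joined to [0]: this matching shows that [matching n] is nonempty, so that
    [dimM n] is its true cardinal. *)
Lemma nci_all_left : nci (fun x => if x == n.+1 then n.+1 else 0%N).
Proof.
by split=> [||x|x|x|x y] //=; rewrite ?eqxx //; do ?case: eqP => //; lia.
Qed.

Lemma card_matching_gt0 : (0 < #|{: matching n}|)%N.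
Proof.
apply/card_gt0P.
by exists (exist (@is_matching n) _ (arcs_is_matching nci_all_left)).
Qed.

Lemma dimME : dimM n = #|{: matching n}|.
Proof. by rewrite /dimM prednK // card_matching_gt0. Qed.

Definition arcs_col (f : nat -> nat) : 'cV[R]_(dimM n) :=
  \col_r (basisM n r == arcs n f)%:R.

Lemma basisM_surj f : nci f -> exists c : 'I_(dimM n), basisM n c = arcs n f.
Proof.
move=> fP.
pose m : matching n := exist (@is_matching n) _ (arcs_is_matching fP).
have mn : (index m (enum {: matching n}) < dimM n)%N.
  by rewrite dimME cardT index_mem mem_enum.
exists (Ordinal mn); rewrite /basisM /= (nth_map m) ?nth_index ?mem_enum //.
by rewrite -cardT -dimME.
Qed.

Lemma basisM_inj : injective (fun c : 'I_(dimM n) => basisM n c).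
Proof.
move=> r c /eqP; rewrite /basisM nth_uniq; first by move/eqP/val_inj.
- by rewrite size_map -cardT -dimME.
- by rewrite size_map -cardT -dimME.
- by rewrite map_inj_uniq ?enum_uniq //; exact: val_inj.
Qed.

Lemma basisM_arcs (c : 'I_(dimM n)) : exists2 f, nci f & basisM n c = arcs n f.
Proof.
pose m0 : matching n :=
  exist (@is_matching n) _ (arcs_is_matching nci_all_left).
exists (mate_fun (basisM n c)); last rewrite arcs_mate_fun //.
  apply: mate_fun_nci.
  rewrite /basisM (nth_map m0); [exact: valP | by rewrite -cardT -dimME].
rewrite /basisM (nth_map m0); [exact: valP | by rewrite -cardT -dimME].
Qed.

Lemma eq_scale_arcs_col (c c' : R) f g : c = c' ->
  (forall x, (x <= n.+1)%N -> f x = g x) -> c *: arcs_col f = c' *: arcs_col g.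
Proof.
move=> -> fg; rewrite /arcs_col (@eq_arcs n f g) // => x x_in.
by apply: fg; lia.
Qed.

Lemma mul_act_mx_col j f : (j <= n)%N -> nci f ->
  E j *m arcs_col f = weight j f *: arcs_col (cupcap n j f).
Proof.
move=> jn fP; have [c cE] := basisM_surj fP.
apply/matrixP => r z; rewrite !mxE (bigD1 c) //= big1 ?addr0 => [|k kc].
  rewrite !mxE cE eqxx mulr1 act_arcs //.
  by case: eqP; rewrite ?mulr1 ?mulr0.
by rewrite [arcs_col _ _ _]mxE -cE (inj_eq basisM_inj) (negbTE kc) mulr0.
Qed.

(** By [basisM_arcs] the vectors [arcs_col f] include the whole standard basis. *)
Lemma eq_mx_arcs_col (M N : 'M[R]_(dimM n)) :
  (forall f, nci f -> M *m arcs_col f = N *m arcs_col f) -> M = N.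
Proof.
move=> MN; apply/matrixP => r c; have [f fP cE] := basisM_arcs c.
have colE (P : 'M[R]_(dimM n)) : (P *m arcs_col f) r 0 = P r c.
  rewrite mxE (bigD1 c) //= big1 ?addr0 => [|k kc].
    by rewrite [arcs_col _ _ _]mxE cE eqxx mulr1.
  by rewrite [arcs_col _ _ _]mxE -cE (inj_eq basisM_inj) (negbTE kc) mulr0.
by rewrite -!colE MN.
Qed.

Lemma mul_act_mx2_col i j f : (i <= n)%N -> (j <= n)%N -> nci f ->
  (E i * E j) *m arcs_col f =
  (weight j f * weight i (cupcap n j f)) *:
    arcs_col (cupcap n i (cupcap n j f)).
Proof.
move=> i_n jn fP; have gP := cupcap_nci fP n_gt0 jn.
transitivity (E i *m (E j *m arcs_col f)); first by rewrite mulmxA.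
rewrite (mul_act_mx_col jn fP) -scalemxAr (mul_act_mx_col i_n gP).
exact: scalerA.
Qed.

(** The second [e_j] meets the loop closed by the first: it changes no arc and contributes the
    scalar of [weight_loop]. *)
Lemma act_mx_sq j : (j <= n)%N -> E j * E j = tl_param n d0 d dn j *: E j.
Proof.
move=> jn; apply: eq_mx_arcs_col => f fP; have gP := cupcap_nci fP n_gt0 jn.
rewrite (mul_act_mx2_col jn jn fP) -scalemxAl (mul_act_mx_col jn fP) scalerA.
apply: eq_scale_arcs_col => [|x xn].
  by rewrite [LHS]mulrC; congr (_ * _); exact: weight_loop.
apply: cupcap_fixed => //.
  by case: posnP => //= j_gt0; rewrite cupcap_left // j_gt0.
by case: eqVneq => //= j_neqn; rewrite cupcap_right //; lia.
Qed.

Lemma act_mx_comm i j : (i.+1 < j)%N -> (j <= n)%N -> E i * E j = E j * E i.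
Proof.
move=> ij jn; have i_n : (i <= n)%N by lia.
apply: eq_mx_arcs_col => f fP.
apply: etrans (mul_act_mx2_col i_n jn fP) _.
apply: etrans _ (esym (mul_act_mx2_col jn i_n fP)).
apply: eq_scale_arcs_col => [|x xn]; first exact/esym/weight_comm.
exact/esym/cupcap_comm.
Qed.

(** The first [e_i] joins [i] to [i.+1], as the straightening lemmas require; the other two
    generators then together act trivially, with weight [1]. *)
Lemma act_mx_zigzag i j : (0 < i < n)%N -> (j == i.+1) || (j.+1 == i) ->
  E i * E j * E i = E i.
Proof.
move=> i_in ij; have [i_n jn] : (i <= n)%N /\ (j <= n)%N by lia.
apply: eq_mx_arcs_col => f fP; have gP := cupcap_nci fP n_gt0 i_n.
have gi : cupcap n i f i = i.+1 by apply: cupcap_left; lia.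
have gi1 : cupcap n i f i.+1 = i by apply: cupcap_right; lia.
transitivity ((E i * E j) *m (E i *m arcs_col f)); first by rewrite mulmxA.
rewrite (mul_act_mx_col i_n fP) -scalemxAr (mul_act_mx2_col i_n jn gP).
rewrite [LHS]scalerA; apply: eq_scale_arcs_col => [|x xn].
  case/orP: ij => /eqP jE; subst.
    have [-> ->] := weight_zigzag_up gP i_in gi gi1 d0 d dn b0 b1.
    by rewrite !mulr1.
  have [/= -> ->] := weight_zigzag_down gP i_in gi gi1 d0 d dn b0 b1.
  by rewrite !mulr1.
case/orP: ij => /eqP jE; subst; first exact: cupcap_zigzag_up.
exact: (@cupcap_zigzag_down n (cupcap n j.+1 f) gP j.+1).
Qed.

Lemma act_mx_TL_relations :
  TL_relations d0 d dn (fun j : 'I_n.+1 => E j).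
Proof.
split=> [i|i j i_in ij|i j].
- by apply: act_mx_sq; rewrite -ltnS.
- exact: act_mx_zigzag.
- case/orP=> ij; first by apply: act_mx_comm; rewrite -1?ltnS.
  by rewrite [RHS]act_mx_comm // -ltnS.
Qed.

End Matrices.

Theorem mainTheorem3 (R : numClosedFieldType) (n : nat) (n_gt0 : (0 < n)%N)
    (d0 d dn b0 b1 : R)
    (hd0 : d0 != 0) (hd : d != 0) (hdn : dn != 0) (hb0 : b0 != 0) (hb1 : b1 != 0)
    (A : algType R) (e : 'I_n.+1 -> A)
    (hTL : is_TL_presentation d0 d dn e) :
  (exists omega : A -> 'M[R]_(dimM n), is_alg_hom omega /\
      forall j : 'I_n.+1, omega (e j) = act_mx n d0 d dn b0 b1 j) /\
  (forall omega omega' : A -> 'M[R]_(dimM n),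
      is_alg_hom omega -> is_alg_hom omega' ->
      (forall j : 'I_n.+1, omega (e j) = act_mx n d0 d dn b0 b1 j) ->
      (forall j : 'I_n.+1, omega' (e j) = act_mx n d0 d dn b0 b1 j) ->
      omega =1 omega').
Proof.
(* The universal property yields existence and uniqueness together, once the matrices satisfy the
   relations. *)
case: hTL => _ universal; apply: universal.
exact: (@act_mx_TL_relations R n d0 d dn b0 b1 n_gt0).
Qed.
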